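(* Let $c=0$ and $n=m=N/2\to\infty$, and consider the pencil $\mathcal{A}_m(\lambda)=H_{2m}-\lambda D_{m,m}$ of $2m\times 2m$ matrices. The eigenvalues of $\mathcal{A}_m$ are all non-real, and those not lying on the imaginary axis satisfy $$\operatorname{Im}(\lambda)=\pm\frac{\Lambda_0(|\operatorname{Re}(\lambda)|)}{2m}+o(m^{-1}),$$ $$\operatorname{Re}(\lambda)=\pm 2\cos\left(\frac{2\pi k}{2m+1}\right)+o(m^{-1}),\qquad k=1,\dots,\left\lfloor \frac m2\right\rfloor,$$ where $$\Lambda_0(u):=\sqrt{4-u^2}\,\log\left(\tan\left(\frac{\pi}{4}+\frac12\arccos\left(\frac u2\right)\right)\right).$$ If $m$ is even, there are no other eigenvalues. If $m$ is odd, there are additionally two purely imaginary eigenvalues at $$\lambda=\pm \mathrm{i}\,\frac{\log(m)}{m}\,(1+o(1)).$$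
   Context: Here $N=2m$ is the size of the matrices, and $c$ denotes the constant diagonal entry of the tridiagonal matrix in the pencil, which is $0$ here: $H_{2m}$ is the real symmetric tridiagonal $2m\times 2m$ matrix with entries $0$ on the diagonal, $1$ where $|r-s|=1$, and $0$ otherwise. $D_{m,n}$ is the diagonal matrix whose first $m$ diagonal entries are $1$ and whose last $n$ diagonal entries are $-1$; here $n=m$. A number $\lambda\in\mathbb{C}$ is an eigenvalue of the pencil $H-\lambda D$ if $H-\lambda D$ is not invertible. $\lfloor\cdot\rfloor$ denotes the integer part.
   Formalization: The o(1/m) formulas for Re and Im are asserted, for each eps, only for eigenvalues with |Re(λ)| or 2cos(2πk/(2m+1)) at least C log(m)/m, with C depending on eps; nearer the imaginary axis they fail (m even, k=m/2: the error in Re is about π/(2m)). *)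

(* Defs.v *)
From HB Require Import structures.
From mathcomp Require Export all_boot all_order all_algebra.
From mathcomp Require Export all_classical all_reals all_analysis.
From mathcomp.real_closed Require Export complex.

Set Implicit Arguments.
Unset Strict Implicit.
Unset Printing Implicit Defensive.

Import Order.TTheory GRing.Theory Num.Theory.
Import numFieldNormedType.Exports.

Local Open Scope ring_scope.

Definition H_mx (K : comUnitRingType) (N : nat) : 'M[K]_N :=
  \matrix_(r < N, s < N) ((s == r.+1 :> nat) || (r == s.+1 :> nat))%:R.

Definition D_mx (K : comUnitRingType) (m n : nat) : 'M[K]_(m + n) :=
  \matrix_(r < m + n, s < m + n)
    (if r == s then (if (r < m)%N then 1 else -1) else 0).

(* The size 2m is written m + m, so that both matrices have the same type. *)
Definition pencil (K : comUnitRingType) (m : nat) (lambda : K) : 'M[K]_(m + m) :=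
  H_mx K (m + m) - lambda *: D_mx K m m.

Definition pencil_eigenvalue (K : comUnitRingType) (m : nat) (lambda : K) : bool :=
  pencil m lambda \notin unitmx.

Definition Lambda0 (R : realType) (u : R) : R :=
  Num.sqrt (4 - u ^+ 2) * ln (tan (pi / 4 + acos (u / 2) / 2)).

Definition limit_re (R : realType) (m k : nat) : R :=
  2 * cos (2 * pi * k%:R / (2 * m + 1)%:R).

(* Main.v *)
Require Import Defs.
From mathcomp Require Import ring lra zify.
Import Order.TTheory GRing.Theory Num.Theory.
Import numFieldNormedType.Exports.
Local Open Scope classical_set_scope.
Local Open Scope ring_scope.

Set Implicit Arguments.
Unset Strict Implicit.
Unset Printing Implicit Defensive.

(** Let p_n be the characteristic polynomial of H_n (a rescaled Chebyshev
    polynomial).  Solving the three-term recursion for a kernel vector from the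
    left shows that z is an eigenvalue iff p_m(z)^2 + p_(m-1)(z)^2 = 0.  With
    z = w + 1/w and w = e^h (cos theta + i sin theta), h > 0, this reads
    w^q (w - i) = 1 - i w, q = 2m+1 (in one half-plane).  Its modulus and
    argument separate: sin theta = cosh h tanh(qh) and q theta + psi = 2 pi k,
    where sin psi = tanh h cosh(qh).  So the solutions lie on an explicit curve
    parametrized by h in [0, hmax], sinh(hmax) sinh(q hmax) = 1, along which the
    phase q theta + psi goes continuously from 0 to (m+1) pi.  The intermediate
    value theorem gives one solution for each k <= m/2, and the endpoint
    theta = psi = pi/2 is an imaginary solution when m is odd.  With their images
    under z -> -z and conjugation these are 2m distinct roots of a polynomial of
    degree 2m, hence all of them.

    For the asymptotics, hmax <= log m/(2m).  The error in the real part is about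
    psi/q and tan psi = sinh h / cos theta, small when Re z >= C log m/m.  If
    cos theta' = Re z / 2 and x = artanh(sin theta'), then Lambda_0 = 2 x tanh x,
    whereas 2m Im z is close to 2 qh tanh(qh); finally
    cosh(qh)/cosh x = cos psi cosh^2 h is close to 1, which forces qh close to
    x. *)

(** * Characteristic equation *)

(* [cheb z n.+1] is the characteristic polynomial of H_n at z: the index is
   shifted so that the p_(-1) = 0 of the recursion is available. *)
Fixpoint cheb (K : comNzRingType) (z : K) (n : nat) : K :=
  match n with
  | 0 => 0
  | 1 => 1
  | (n'.+1 as n1).+1 => z * cheb z n1 - cheb z n'
  end.

Lemma chebSS (K : comNzRingType) (z : K) n :
  cheb z n.+2 = z * cheb z n.+1 - cheb z n.
Proof. by []. Qed.

Lemma cheb_rmorph (K L : comNzRingType) (f : {rmorphism K -> L}) z n :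
  f (cheb z n) = cheb (f z) n.
Proof.
suff: f (cheb z n) = cheb (f z) n /\ f (cheb z n.+1) = cheb (f z) n.+1 by case.
elim: n => [|n [IH1 IH2]]; first by rewrite /= rmorph0 rmorph1.
by split=> //; rewrite !chebSS rmorphB rmorphM IH1 IH2.
Qed.

Lemma chebN (K : comNzRingType) (z : K) n :
  cheb (- z) n = - (-1) ^+ n * cheb z n.
Proof.
suff: cheb (- z) n = - (-1) ^+ n * cheb z n /\
      cheb (- z) n.+1 = - (-1) ^+ n.+1 * cheb z n.+1 by case.
elim: n => [|n [IH1 IH2]]; first by rewrite /= expr1 mulr0 opprK mulr1.
by split=> //; rewrite !chebSS IH1 IH2 !exprS; ring.
Qed.

Lemma size_cheb (K : idomainType) n : size (cheb ('X : {poly K}) n) = n.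
Proof.
suff: size (cheb ('X : {poly K}) n) = n /\
      size (cheb ('X : {poly K}) n.+1) = n.+1 by case.
elim: n => [|n [IH1 IH2]]; first by rewrite /= size_poly0 size_poly1.
split=> //; rewrite chebSS.
have nz : cheb ('X : {poly K}) n.+1 != 0 by rewrite -size_poly_eq0 IH2.
by rewrite size_polyDl mulrC size_mulX ?IH2// size_polyN IH1.
Qed.

Definition charE (K : comNzRingType) (m : nat) (z : K) : K :=
  cheb z m.+1 ^+ 2 + cheb z m ^+ 2.

Lemma charEN (K : comNzRingType) m (z : K) : charE m (- z) = charE m z.
Proof.
by rewrite /charE !chebN !exprMn !sqrrN !sqrr_sign !mul1r.
Qed.

Lemma charE_rmorph (K L : comNzRingType) (f : {rmorphism K -> L}) m z :
  f (charE m z) = charE m (f z).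
Proof. by rewrite /charE rmorphD !rmorphXn !cheb_rmorph. Qed.

Lemma size_charE (K : idomainType) m : size (charE m ('X : {poly K})) = m.*2.+1.
Proof.
have nz n : (0 < n)%N -> cheb ('X : {poly K}) n != 0.
  by move=> n0; rewrite -size_poly_eq0 size_cheb -lt0n.
have sz n : (0 < n)%N -> size (cheb ('X : {poly K}) n ^+ 2) = (n + n).-1.
  by move=> n0; rewrite expr2 size_mul ?nz// !size_cheb.
rewrite /charE size_polyDl; first by rewrite sz//; lia.
rewrite [ltnRHS]sz//; case: m => [|m]; first by rewrite expr0n size_poly0.
by rewrite sz//; lia.
Qed.

(** The polynomial has degree 2m by [size_charE], so 2m distinct roots exhaust it. This is what
    makes an explicit list of eigenvalues complete. *)
Lemma charE_roots (K : idomainType) m (s : seq K) (z : K) :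
  uniq s -> size s = m.*2 -> {in s, forall x, charE m x = 0} ->
  charE m z = 0 -> z \in s.
Proof.
move=> us ss rs rz; apply: contraT => zs.
have hor x : (charE m ('X : {poly K})).[x] = charE m x.
  by rewrite -[LHS]/(horner_eval x _) charE_rmorph /= /horner_eval hornerX.
have := @max_poly_roots K (charE m 'X) (z :: s).
rewrite -size_poly_eq0 size_charE /= ss ltnn zs us rootE hor rz eqxx /=.
by move=> -> //; apply/allP => x xs; rewrite rootE hor rs.
Qed.

(** * Left kernel vectors of the pencil *)

Section Kernel.
Variables (K : fieldType) (m : nat) (z : K).

Let diag (r : nat) : K := if (r < m)%N then z else - z.

(** The candidate kernel vector with first coordinate 1, shifted by one so that index 0 carries the
    left boundary value. *)
Fixpoint ker_seq (n : nat) : K :=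
  match n with
  | 0 => 0
  | 1 => 1
  | (n'.+1 as n1).+1 => diag n' * ker_seq n1 - ker_seq n'
  end.

Lemma ker_seqSS n : ker_seq n.+2 = diag n * ker_seq n.+1 - ker_seq n.
Proof. by []. Qed.

Lemma ker_seq_low n : (n <= m)%N ->
  ker_seq n = cheb z n /\ ker_seq n.+1 = cheb z n.+1.
Proof.
elim: n => [|n IH] nm //.
have [e1 e2] := IH (ltnW nm); split=> //.
by rewrite ker_seqSS chebSS e1 e2 /diag nm.
Qed.

(** Past index m the recursion is that of [cheb] at [- z], so its solution is a combination of two
    shifted copies, fixed by the values at m and m+1. *)
Lemma ker_seq_high j : ker_seq (m + j).+1 =
  cheb (- z) j.+1 * ker_seq m.+1 - cheb (- z) j * ker_seq m.
Proof.
suff : ker_seq (m + j).+1 =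
     cheb (- z) j.+1 * ker_seq m.+1 - cheb (- z) j * ker_seq m /\
   ker_seq (m + j).+2 =
     cheb (- z) j.+2 * ker_seq m.+1 - cheb (- z) j.+1 * ker_seq m by case.
elim: j => [|i [IH1 IH2]].
  rewrite addn0; split; first by rewrite /=; ring.
  by rewrite ker_seqSS /diag ltnn /=; ring.
rewrite addnS; split=> //; rewrite ker_seqSS IH1 IH2 /diag.
have -> : ((m + i).+1 < m)%N = false by lia.
by rewrite !chebSS; ring.
Qed.

(** The parity [chebN] turns both products into squares with the same sign. *)
Lemma ker_seq_last : ker_seq (m + m).+1 = (-1) ^+ m * charE m z.
Proof.
rewrite ker_seq_high !chebN /charE.
have [-> ->] := ker_seq_low (leqnn m).
by rewrite !exprS; ring.
Qed.

(** Zero padding at both ends gives the first and last columns the same three-term form as the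
    others. *)
Let ext (v : 'rV[K]_(m + m)) (n : nat) : K :=
  if n is n'.+1 then (if insub n' is Some i then v 0 i else 0) else 0.

Lemma extE v (i : 'I_(m + m)) : ext v i.+1 = v 0 i.
Proof. by rewrite /ext valK. Qed.

Lemma ext_last v : ext v (m + m).+1 = 0.
Proof. by rewrite /ext insubN // ltnn. Qed.

Lemma mul_pencil v (s : 'I_(m + m)) :
  (v *m pencil m z) 0 s = ext v s + ext v s.+2 - diag s * ext v s.+1.
Proof.
rewrite /pencil mulmxBr -scalemxAr [LHS]mxE [X in _ + X]mxE [X in _ - X]mxE.
congr (_ - _); rewrite mxE.
  under eq_bigr => r _ do rewrite mxE.
  have -> : ext v s = \sum_(r < m + m) v 0 r * (s == r.+1 :> nat)%:R.
    case: s => -[|s] /= sN.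
      by rewrite big1// => i _; rewrite mulr0.
    rewrite (bigD1 (Ordinal (ltnW sN)))//= eqxx mulr1 big1 ?addr0 //.
      by rewrite -extE.
    move=> i; rewrite -val_eqE /= => /negbTE is_.
    by rewrite eqSS eq_sym is_ mulr0.
  have -> : ext v s.+2 = \sum_(r < m + m) v 0 r * (r == s.+1 :> nat)%:R.
    have [sN|sN] := ltnP s.+1 (m + m).
      rewrite (bigD1 (Ordinal sN))//= eqxx mulr1 big1 ?addr0 //.
        by rewrite -extE.
      by move=> i; rewrite -val_eqE /= => /negbTE ->; rewrite mulr0.
    rewrite big1 => [|i _]; first by rewrite /ext insubN // -leqNgt.
    by rewrite ltn_eqF ?mulr0// (leq_trans (ltn_ord i)).
  rewrite -big_split; apply: eq_bigr => i _ /=; rewrite -mulrDr; congr (_ * _).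
  have [->|_] := eqVneq (s : nat) i.+1; last by rewrite add0r.
  by rewrite -[_ == _]/(i == i.+2 :> nat) ltn_eqF ?addr0.
rewrite extE (bigD1 s)//= mxE eqxx big1 ?addr0.
  by rewrite /diag; case: ifP => _; ring.
by move=> i /negbTE is_; rewrite mxE is_ mulr0.
Qed.

(** A left kernel vector obeys the recursion, hence is a multiple of [ker_seq]; the one remaining
    condition is the zero at index 2m+1. *)
Lemma pencil_eigenvalueE : pencil_eigenvalue m z = (charE m z == 0).
Proof.
rewrite /pencil_eigenvalue unitmxE unitfE negbK; apply/det0P/eqP.
  move=> [v v0 vA].
  have rec (s : 'I_(m + m)) : ext v s.+2 = diag s * ext v s.+1 - ext v s.
    have := mul_pencil v s; rewrite vA mxE => /eqP.
    by rewrite eq_sym subr_eq add0r addrC => /eqP <-; ring.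
  have extY n : (n <= m + m)%N ->
      ext v n = ext v 1 * ker_seq n /\ ext v n.+1 = ext v 1 * ker_seq n.+1.
    elim: n => [|n IH] nm; first by rewrite /= mulr0 mulr1.
    have [e1 e2] := IH (ltnW nm); split=> //.
    have -> : ext v n.+2 = diag n * ext v n.+1 - ext v n := rec (Ordinal nm).
    by rewrite ker_seqSS e1 e2; ring.
  have v1 : ext v 1 != 0.
    apply: contra_neq v0 => v1; apply/rowP => i.
    by rewrite mxE -extE (extY _ (ltn_ord i)).1 v1 mul0r.
  have := (extY _ (leqnn _)).2; rewrite ext_last ker_seq_last => /esym/eqP.
  by rewrite !mulf_eq0 (negbTE v1) signr_eq0 => /eqP.
move=> E0; have := ker_seq_last; rewrite E0 mulr0 => last0.
(* The empty matrix is excluded because [charE 0 z] is 1. *)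
have m0 : (0 < m + m)%N.
  rewrite addn_gt0 orbb lt0n; apply: contra_eq_neq E0 => ->.
  by rewrite /charE /= expr0n addr0 expr1n oner_neq0.
pose v := \row_(i < m + m) ker_seq i.+1.
have extv n : (n <= (m + m).+1)%N -> ext v n = ker_seq n.
  case: n => [//|n]; rewrite ltnS leq_eqVlt => /predU1P[->|nm].
    by rewrite last0 ext_last.
  by rewrite -[n]/(val (Ordinal nm)) extE mxE.
exists v.
  by apply/eqP => /rowP /(_ (Ordinal m0)) /eqP; rewrite !mxE /= oner_eq0.
apply/rowP => s; rewrite mul_pencil mxE.
have sN := ltn_ord s.
by rewrite !extv ?ker_seqSS; first ring; lia.
Qed.

End Kernel.

(** * Hyperbolic functions *)

Section Hyperbolic.
Variable R : realType.
Implicit Types x y d : R.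

Definition cosh x : R := (expR x + expR (- x)) / 2.
Definition sinh x : R := (expR x - expR (- x)) / 2.

Lemma sinh0 : sinh 0 = 0.
Proof. by rewrite /sinh oppr0 expR0 subrr mul0r. Qed.

Lemma cosh_gt0 x : 0 < cosh x.
Proof. by rewrite /cosh divr_gt0 ?addr_gt0 ?expR_gt0. Qed.

Lemma coshN x : cosh (- x) = cosh x.
Proof. by rewrite /cosh opprK addrC. Qed.

Lemma sinhN x : sinh (- x) = - sinh x.
Proof. by rewrite /sinh opprK -opprB mulNr. Qed.

Lemma coshD x y : cosh (x + y) = cosh x * cosh y + sinh x * sinh y.
Proof. by rewrite /cosh /sinh opprD !expRD; field. Qed.

Lemma sinhD x y : sinh (x + y) = sinh x * cosh y + cosh x * sinh y.
Proof. by rewrite /cosh /sinh opprD !expRD; field. Qed.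

Lemma expR_coshDsinh x : expR x = cosh x + sinh x.
Proof. by rewrite /cosh /sinh; field. Qed.

Lemma expRN_coshBsinh x : expR (- x) = cosh x - sinh x.
Proof. by rewrite /cosh /sinh; field. Qed.

Lemma cosh2 x : cosh x ^+ 2 = 1 + sinh x ^+ 2.
Proof.
have e := expRxMexpNx_1 x; rewrite expR_coshDsinh expRN_coshBsinh in e.
by rewrite -e; ring.
Qed.

Lemma le_sinh : {mono sinh : x y / x <= y}.
Proof.
apply: le_mono => x y xy.
rewrite /sinh ltr_pM2r ?invr_gt0//.
by rewrite ltrB// ?ltr_expR// ltrN2.
Qed.

Lemma lt_sinh : {mono sinh : x y / x < y}.
Proof. exact: leW_mono le_sinh. Qed.

Lemma sinh_gt0 x : 0 < x -> 0 < sinh x.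
Proof. by rewrite -{2}sinh0 lt_sinh. Qed.

Lemma sinh_ge0 x : 0 <= x -> 0 <= sinh x.
Proof. by rewrite -{2}sinh0 le_sinh. Qed.

Lemma is_derive_expRN x : is_derive x 1 (fun t : R => expR (- t)) (- expR (- x)).
Proof.
have := @is_derive1_comp R (@expR R) -%R x (expR (- x)) (- 1) _ _.
by rewrite mulrN1; apply; exact: is_derive_expR.
Qed.

Lemma is_derive_sinh x : is_derive x 1 sinh (cosh x).
Proof.
rewrite /sinh /cosh.
have h := is_derive_expRN x.
by apply: is_derive_eq; rewrite /GRing.scale /=; field.
Qed.

Lemma continuous_expRN : continuous (fun t : R => expR (- t)).
Proof.
by move=> x; apply: continuous_comp; [exact: opp_continuous|exact: continuous_expR].
Qed.

Lemma continuous_sinh : continuous sinh.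
Proof.
move=> x; apply: cvgM; last exact: cvg_cst.
by apply: cvgB; [exact: continuous_expR|exact: continuous_expRN].
Qed.

Lemma continuous_cosh : continuous cosh.
Proof.
move=> x; apply: cvgM; last exact: cvg_cst.
by apply: cvgD; [exact: continuous_expR|exact: continuous_expRN].
Qed.

Lemma cosh_ge1 x : 1 <= cosh x.
Proof.
by have := cosh_gt0 x; have := cosh2 x; have := sqr_ge0 (sinh x); nra.
Qed.

Lemma sinh_ge x : 0 <= x -> x <= sinh x.
Proof.
rewrite le_eqVlt => /predU1P[<-|x0]; first by rewrite sinh0.
have [|c _] := @MVT R sinh cosh 0 x x0 (fun t _ => is_derive_sinh t).
  by apply: continuous_subspaceT => t; exact: continuous_sinh.
by rewrite sinh0 !subr0 => ->; rewrite ler_peMl ?cosh_ge1 // ltW.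
Qed.

(** Follows from [1 - x <= expR (- x)], whose inverse bounds [expR x] by 1/(1-x), at most 1 + x +
    2x^2 for x up to 1/2. *)
Lemma sinh_le x : 0 <= x <= 2^-1 -> sinh x <= x + x ^+ 2.
Proof.
move=> /andP[x0 x1].
have a : 1 - x <= expR (- x) by rewrite expR_ge1Dx.
have b : expR x <= (1 - x)^-1.
  rewrite -[expR x]opprK -[x in expR x]opprK expRN opprK lef_pV2 ?posrE ?expR_gt0//.
  by lra.
have c : (1 - x)^-1 <= 1 + x + x ^+ 2 * 2.
  by rewrite -[leLHS]mul1r ler_pdivrMr; nra.
by rewrite /sinh; lra.
Qed.

(** Duplication gives cosh x = 1 + 2 sinh(x/2)^2, and sinh(x/2) is at least x/2. *)
Lemma cosh_ge x : 1 + x ^+ 2 / 2 <= cosh x.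
Proof.
wlog x0 : x / 0 <= x.
  by move=> H; have [/H//|/ltW x0] := leP 0 x; rewrite -coshN -sqrrN H// oppr_ge0.
have -> : cosh x = 1 + 2 * sinh (x / 2) ^+ 2.
  by rewrite [in LHS](_ : x = x / 2 + x / 2) ?coshD;
    [have := cosh2 (x / 2); lra|field].
have : x / 2 <= sinh (x / 2) by rewrite sinh_ge//; lra.
nra.
Qed.

Lemma cosh_le x : cosh x <= 1 + sinh x ^+ 2.
Proof. by rewrite -cosh2 ler_eXnr ?cosh_ge1. Qed.

End Hyperbolic.

(** * Trigonometry *)

Section Trigonometry.
Variable R : realType.
Implicit Types x t : R.

Lemma cos_lipschitz x t : x <= t -> `|cos t - cos x| <= t - x.
Proof.
move=> xt.
have [|c _ ->] := @MVT_segment R cos (fun x => - sin x) x t xt.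
  by apply: continuous_subspaceT; exact: continuous_cos.
by rewrite normrM normrN (ger0_norm (_ : 0 <= t - x)) ?subr_ge0//
  ler_piMl ?subr_ge0// sin_max.
Qed.

Lemma atan_le x : 0 <= x -> atan x <= x.
Proof.
move=> x0.
have [|c _] := @MVT_segment R atan (fun x => (1 + x ^+ 2)^-1) 0 x x0.
  by apply: continuous_subspaceT => u; exact: continuous_atan.
rewrite atan0 !subr0 => ->; rewrite ler_piMl// invf_le1 ?lerDl ?sqr_ge0//.
by rewrite ltr_pwDl ?sqr_ge0.
Qed.

Lemma cos2kpi k : cos (2 * pi * k%:R) = 1 :> R.
Proof.
have := periodicn (@cosD2pi R) k 0.
by rewrite add0r cos0 -[_ *+ k]mulr_natr -[pi *+ 2]mulr_natl.
Qed.

Lemma sin2kpi k : sin (2 * pi * k%:R) = 0 :> R.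
Proof.
have := periodicn (@sinD2pi R) k 0.
by rewrite add0r sin0 -[_ *+ k]mulr_natr -[pi *+ 2]mulr_natl.
Qed.

(* Equals arcsin on [-1, 1]; unlike [asin], known to be continuous everywhere,
   endpoints included. *)
Definition arcsin x : R := 2 * atan (x / (1 + Num.sqrt (1 - x ^+ 2))).

Lemma continuous_arcsin : continuous arcsin.
Proof.
move=> x; apply: cvgM; first exact: cvg_cst.
apply: (@continuous_comp _ _ _ (fun x => x / (1 + Num.sqrt (1 - x ^+ 2))) (@atan R)).
  apply: cvgM; first exact: cvg_id.
  apply: cvgV; first by rewrite gt_eqF// ltr_pwDl// sqrtr_ge0.
  apply: cvgD; first exact: cvg_cst.
  apply: (@continuous_comp _ _ _ (fun x => 1 - x ^+ 2) (@Num.sqrt R)).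
    by apply: cvgB; [exact: cvg_cst|exact: exprn_continuous].
  exact: sqrt_continuous.
exact: continuous_atan.
Qed.

Lemma sin2atan t : sin (2 * atan t) = 2 * t / (1 + t ^+ 2) /\
  cos (2 * atan t) = 2 / (1 + t ^+ 2) - 1.
Proof.
have c0 : cos (atan t) != 0.
  by rewrite gt_eqF// cos_gt0_pihalf// atan_gtNpi2 atan_ltpi2.
have t0 : 1 + t ^+ 2 != 0 by rewrite gt_eqF// ltr_pwDl ?sqr_ge0.
have := cos2_tan2 c0; rewrite atanK => /(congr1 GRing.inv); rewrite invrK => c2.
have := atanK t; rewrite /tan => /(canRL (divfK c0)) s.
rewrite !mulr_natl sin_mulr2n cos_mulr2n s mulrCA -expr2 c2.
by split; field.
Qed.

(** The quotient x/(1+c), with c the cosine, is the tangent of the half angle, and 1 + (x/(1+c))^2 =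
    2/(1+c). *)
Lemma arcsinK x : 0 <= x <= 1 ->
  sin (arcsin x) = x /\ cos (arcsin x) = Num.sqrt (1 - x ^+ 2).
Proof.
move=> /andP[x0 x1]; rewrite /arcsin; set c := Num.sqrt _.
have c0 : 0 <= c by rewrite sqrtr_ge0.
have c2 : c ^+ 2 = 1 - x ^+ 2 by rewrite sqr_sqrtr//; nra.
have [-> ->] := sin2atan (x / (1 + c)).
have nz : 1 + c != 0 by rewrite gt_eqF//; lra.
have -> : 1 + (x / (1 + c)) ^+ 2 = 2 / (1 + c).
  transitivity (((1 + c) ^+ 2 + x ^+ 2) / (1 + c) ^+ 2); first by field.
  have -> : (1 + c) ^+ 2 + x ^+ 2 = 2 * (1 + c) by rewrite sqrrD c2; ring.
  by field.
by split; field.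
Qed.

Lemma arcsin0 : arcsin 0 = 0.
Proof. by rewrite /arcsin mul0r atan0 mulr0. Qed.

Lemma arcsin1 : arcsin 1 = pi / 2.
Proof.
by rewrite /arcsin expr1n subrr sqrtr0 addr0 divr1 atan1; field.
Qed.

Lemma arcsin_bounds x : 0 <= x <= 1 ->
  [/\ 0 <= arcsin x, arcsin x <= pi / 2 & arcsin x <= 2 * x].
Proof.
move=> /andP[x0 x1]; rewrite /arcsin; set c := Num.sqrt _.
have c0 : 0 <= c by rewrite sqrtr_ge0.
have t0 : 0 <= x / (1 + c) by rewrite divr_ge0//; lra.
have tx : x / (1 + c) <= x by rewrite ler_pdivrMr; nra.
have a0 : 0 <= atan (x / (1 + c)) by rewrite -atan0 le_atan.
have a1 : atan (x / (1 + c)) <= pi / 4 by rewrite -atan1 le_atan// (le_trans tx).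
have a2 := atan_le t0.
by split; lra.
Qed.

End Trigonometry.

(** * The characteristic equation in the Joukowsky variable *)

(** The closed form of the Chebyshev polynomials, with [v] the inverse of [w]; multiplying by
    [w - v] avoids a division. *)
Lemma cheb_joukowsky (K : comNzRingType) (w v : K) n : w * v = 1 ->
  (w - v) * cheb (w + v) n = w ^+ n - v ^+ n.
Proof.
move=> wv.
suff: (w - v) * cheb (w + v) n = w ^+ n - v ^+ n /\
      (w - v) * cheb (w + v) n.+1 = w ^+ n.+1 - v ^+ n.+1 by case.
elim: n => [|n [IH1 IH2]]; first by rewrite /= !expr0 !expr1; split; ring.
split=> //; rewrite chebSS mulrBr IH1 mulrCA IH2 !exprS.
transitivity (w * (w * w ^+ n) - v * (v * v ^+ n) + (w * v - 1) * (w ^+ n - v ^+ n)).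
  by ring.
by rewrite wv; ring.
Qed.

(* w^(2m+1) (w - i) = 1 - i w amounts to p_m = i p_(m-1), one of the two factors
   of p_m^2 + p_(m-1)^2. *)
Lemma charE_joukowsky (K : fieldType) (i w v : K) m : i ^+ 2 = -1 ->
  w * v = 1 -> w != v -> w ^+ m.*2.+1 * (w - i) = 1 - i * w ->
  charE m (w + v) = 0.
Proof.
move=> i2 wv nwv hw.
have w0 : w != 0.
  by apply: contra_eq_neq wv => ->; rewrite mul0r eq_sym oner_neq0.
have d0 : w - v != 0 by rewrite subr_eq0.
(* This is p_m = i p_(m-1) multiplied by [w - v]; a factor w^(m+1) clears the powers of [v]. *)
have key : w ^+ m.+1 - v ^+ m.+1 = i * (w ^+ m - v ^+ m).
  apply: (mulfI (expf_neq0 m.+1 w0)).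
  have -> : w ^+ m.+1 * (w ^+ m.+1 - v ^+ m.+1) = w ^+ m.*2.+1 * w - 1.
    rewrite mulrBr -exprD -exprMn wv expr1n -exprSr; congr (_ ^+ _ - _); lia.
  have -> : w ^+ m.+1 * (i * (w ^+ m - v ^+ m)) = i * (w ^+ m.*2.+1 - w).
    rewrite mulrCA mulrBr -exprD exprS -mulrA -exprMn wv expr1n mulr1.
    by congr (_ * (_ ^+ _ - _)); lia.
  have -> : w ^+ m.*2.+1 * w = 1 - i * w + w ^+ m.*2.+1 * i by rewrite -hw; ring.
  by ring.
apply: (mulfI d0); apply: (mulfI d0); rewrite /charE !mulr0.
transitivity (((w - v) * cheb (w + v) m.+1) ^+ 2 + ((w - v) * cheb (w + v) m) ^+ 2).
  by ring.
by rewrite !cheb_joukowsky// key exprMn i2; ring.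
Qed.

(** * The solution curve *)

Section Curve.
Variables (R : realType) (m : nat).
Implicit Types h : R.

Local Notation q := (m.*2.+1%:R : R).

Definition theta h : R := arcsin (cosh h * (sinh (q * h) / cosh (q * h))).
Definition psi h : R := arcsin (sinh h / cosh h * cosh (q * h)).
Definition phase h : R := q * theta h + psi h.
Definition curve h : R[i] :=
  Complex (2 * cosh h * cos (theta h)) (2 * sinh h * sin (theta h)).

Lemma q_gt0 : 0 < q.
Proof. by rewrite ltr0n. Qed.

Lemma q_ge1 : 1 <= q.
Proof. by rewrite ler1n. Qed.

(** With a = sinh h and b = sinh(qh), one minus the square of either sine is (1 - (ab)^2) over a
    squared cosh. So the bound ab <= 1 puts both arguments in [0, 1], and the two cosines share the
    numerator [D]. *)
Lemma curve_angles h : 0 <= h -> sinh h * sinh (q * h) <= 1 ->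
  let D := Num.sqrt (1 - (sinh h * sinh (q * h)) ^+ 2) in
  [/\ 0 <= cosh h * (sinh (q * h) / cosh (q * h)) <= 1,
      0 <= sinh h / cosh h * cosh (q * h) <= 1,
      sin (theta h) = cosh h * (sinh (q * h) / cosh (q * h)) /\
        cos (theta h) = D / cosh (q * h) &
      sin (psi h) = sinh h / cosh h * cosh (q * h) /\ cos (psi h) = D / cosh h].
Proof.
move=> h0 ab1; have q1 := q_ge1; rewrite /theta /psi.
have a0 := sinh_ge0 h0.
have b0 : 0 <= sinh (q * h) by rewrite sinh_ge0// mulr_ge0.
have := cosh_gt0 h; have := cosh_gt0 (q * h).
have := cosh2 h; have := cosh2 (q * h).
move: (sinh h) (sinh (q * h)) (cosh h) (cosh (q * h)) a0 b0 ab1.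
move=> a b A B a0 b0 ab1 BE AE B0 A0.
have ab2 : (a * b) ^+ 2 <= 1.
  by rewrite expr_le1// mulr_ge0.
have X0 : 0 <= A * (b / B) by rewrite mulr_ge0 ?divr_ge0// ltW.
have Y0 : 0 <= a / A * B by rewrite mulr_ge0 ?divr_ge0// ltW.
have nA := lt0r_neq0 A0; have nB := lt0r_neq0 B0.
have X2 : 1 - (A * (b / B)) ^+ 2 = (1 - (a * b) ^+ 2) / B ^+ 2.
  transitivity ((B ^+ 2 - A ^+ 2 * b ^+ 2) / B ^+ 2); first by field.
  by congr (_ / _); rewrite AE BE; ring.
have Y2 : 1 - (a / A * B) ^+ 2 = (1 - (a * b) ^+ 2) / A ^+ 2.
  transitivity ((A ^+ 2 - B ^+ 2 * a ^+ 2) / A ^+ 2); first by field.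
  by congr (_ / _); rewrite AE BE; ring.
have sub0 : 0 <= 1 - (a * b) ^+ 2 by rewrite subr_ge0.
have le1 (x : R) : 0 <= x -> 0 <= 1 - x ^+ 2 -> 0 <= x <= 1 by move=> x0; nra.
have X1 := le1 _ X0; rewrite X2 divr_ge0 ?sqr_ge0// in X1.
have Y1 := le1 _ Y0; rewrite Y2 divr_ge0 ?sqr_ge0// in Y1.
have {}X1 := X1 isT; have {}Y1 := Y1 isT.
split=> //.
  have [-> ->] := arcsinK X1; rewrite X2 sqrtrM// sqrtrV ?sqr_ge0//.
  by rewrite sqrtr_sqr ger0_norm// ltW.
have [-> ->] := arcsinK Y1; rewrite Y2 sqrtrM// sqrtrV ?sqr_ge0//.
by rewrite sqrtr_sqr ger0_norm// ltW.
Qed.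

Lemma polarX (r t : R) n :
  (Complex (r * cos t) (r * sin t)) ^+ n =
  Complex (r ^+ n * cos (n%:R * t)) (r ^+ n * sin (n%:R * t)).
Proof.
elim: n => [|n IH]; first by rewrite !expr0 mul0r cos0 sin0 mulr1 mulr0.
rewrite exprS IH -natr1 mulrDl mul1r cosD sinD exprS.
by apply/eqP; rewrite eq_complex /=; apply/andP; split; apply/eqP; ring.
Qed.

(** The phase condition makes q theta equal to -psi modulo 2 pi. The equation w^q (w - i) = 1 - i w
    then splits into two identities between exponentials of h and qh. *)
Lemma curve_charE h k : 0 < h -> sinh h * sinh (q * h) <= 1 ->
  phase h = 2 * pi * k%:R -> charE m (curve h) = 0.
Proof.
move=> h0 ab1 ph.
have [_ _ [sT cT] [sP cP]] := curve_angles (ltW h0) ab1.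
set D := Num.sqrt _ in cT cP.
have D2 : D ^+ 2 = 1 - (sinh h * sinh (q * h)) ^+ 2.
  rewrite sqr_sqrtr// subr_ge0 expr_le1// mulr_ge0// sinh_ge0 ?ltW//.
  by rewrite mulr_gt0.
have qT : q * theta h = 2 * pi * k%:R - psi h by rewrite -ph /phase addrK.
have cq : cos (q * theta h) = cos (psi h).
  by rewrite qT cosB cos2kpi sin2kpi mul1r mul0r addr0.
have sq : sin (q * theta h) = - sin (psi h).
  by rewrite qT sinB cos2kpi sin2kpi mul1r mul0r add0r.
pose w : R[i] := Complex (expR h * cos (theta h)) (expR h * sin (theta h)).
pose v : R[i] :=
  Complex (expR (- h) * cos (theta h)) (- (expR (- h) * sin (theta h))).
have qh0 : 0 < q * h by rewrite mulr_gt0 ?q_gt0.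
have e0 := expR_gt0 h; have f0 := expR_gt0 (q * h).
have sT0 : 0 < sin (theta h).
  by rewrite sT; exact: mulr_gt0 (cosh_gt0 _) (divr_gt0 (sinh_gt0 qh0) (cosh_gt0 _)).
have wv : curve h = w + v.
  apply/eqP; rewrite eq_complex /= expR_coshDsinh expRN_coshBsinh.
  by apply/andP; split; apply/eqP; ring.
rewrite wv; apply: (@charE_joukowsky _ (Complex 0 1)).
- by apply/eqP; rewrite eq_complex /=; apply/andP; split; apply/eqP; ring.
- apply/eqP; rewrite eq_complex /=; apply/andP; split; apply/eqP; last by ring.
  transitivity (expR h * expR (- h) * (cos (theta h) ^+ 2 + sin (theta h) ^+ 2)).
    by ring.
  by rewrite expRxMexpNx_1 cos2Dsin2 mulr1.
- rewrite eq_complex /= negb_and; apply/orP; right; rewrite gt_eqF//.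
  by rewrite (@lt_trans _ _ 0) ?oppr_lt0 ?mulr_gt0 ?expR_gt0.
rewrite /w polarX cq sq -expRM_natl sT cT sP cP.
(* Both parts of the equation, with sines and cosines replaced by their expressions in h. Only the
   real part contains [D] squared. *)
have real_part : expR (q * h) * (D ^+ 2 * (expR h / cosh h / cosh (q * h))
    + sinh h / cosh h * cosh (q * h) *
      (expR h * (cosh h * (sinh (q * h) / cosh (q * h))) - 1))
    = 1 + expR h * (cosh h * (sinh (q * h) / cosh (q * h))).
  rewrite D2 /cosh /sinh !expRN; field.
  by rewrite !gt_eqF ?mulr_gt0//; nra.
have imag_part : expR (q * h) * (D / cosh h *
    (expR h * (cosh h * (sinh (q * h) / cosh (q * h))) - 1)
    - sinh h / cosh h * cosh (q * h) * (expR h * (D / cosh (q * h))))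
    = - (expR h * (D / cosh (q * h))).
  rewrite /cosh /sinh !expRN; field.
  by rewrite !gt_eqF ?mulr_gt0//; nra.
apply/eqP; rewrite eq_complex /=; apply/andP; split; apply/eqP.
  transitivity (1 + expR h * (cosh h * (sinh (q * h) / cosh (q * h)))).
    by rewrite -real_part; ring.
  by ring.
transitivity (- (expR h * (D / cosh (q * h)))); first by rewrite -imag_part; ring.
by ring.
Qed.

End Curve.

(** * Parameters of the eigenvalues on the curve, and completeness of the list *)

Section Nodes.
Variables (R : realType) (m : nat).
Implicit Types h : R.

Local Notation q := (m.*2.+1%:R : R).

Lemma continuous_scaled (f : R -> R) :
  continuous f -> continuous (fun h => f (q * h)).
Proof.
move=> cf h; apply: (@continuous_comp _ _ _ (fun h => q * h) f); last exact: cf.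
exact: mulrl_continuous.
Qed.

(** No bound on h is needed, since [arcsin] is continuous on the whole line. *)
Lemma continuous_phase : continuous (phase m : R -> R).
Proof.
have cC := @continuous_cosh R; have cS := @continuous_sinh R.
have nC (x : R) : cosh x != 0 by rewrite lt0r_neq0 ?cosh_gt0.
move=> h; apply: cvgD.
  apply: cvgM; first exact: cvg_cst.
  apply: (@continuous_comp _ _ _
    (fun h => cosh h * (sinh (q * h) / cosh (q * h))) (@arcsin R)).
    apply: cvgM; first exact: cC.
    apply: cvgM; first exact: continuous_scaled.
    by apply: cvgV => //; exact: continuous_scaled.
  exact: continuous_arcsin.
apply: (@continuous_comp _ _ _
  (fun h => sinh h / cosh h * cosh (q * h)) (@arcsin R)).
  apply: cvgM; last exact: continuous_scaled.
  by apply: cvgM; [exact: cS|apply: cvgV => //; exact: cC].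
exact: continuous_arcsin.
Qed.

Lemma phase0 : phase m 0 = 0 :> R.
Proof.
by rewrite /phase /theta /psi mulr0 sinh0 !mul0r mulr0 arcsin0 mulr0 addr0.
Qed.

(** At this endpoint [D] vanishes, so both cosines are 0 and both nonnegative sines are 1. *)
Lemma angles_end h : 0 <= h -> sinh h * sinh (q * h) = 1 ->
  theta m h = pi / 2 /\ psi m h = pi / 2.
Proof.
move=> h0 ab1.
have ab : sinh h * sinh (q * h) <= 1 by rewrite ab1.
have [X1 Y1 [sT cT] [sP cP]] := curve_angles h0 ab.
rewrite ab1 expr1n subrr sqrtr0 mul0r in cT.
rewrite ab1 expr1n subrr sqrtr0 mul0r in cP.
have one (x : R) : 0 <= x -> x ^+ 2 = 1 -> x = 1 by move=> x0 x2; nra.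
have X := cos2Dsin2 (theta m h); rewrite cT sT expr0n add0r in X.
have Y := cos2Dsin2 (psi m h); rewrite cP sP expr0n add0r in Y.
have [X0 _] := andP X1; have [Y0 _] := andP Y1.
by rewrite /theta /psi (one _ X0 X) (one _ Y0 Y) arcsin1.
Qed.

Lemma phase_end h : 0 <= h -> sinh h * sinh (q * h) = 1 ->
  phase m h = m.+1%:R * pi.
Proof.
move=> h0 ab1; have [eT eP] := angles_end h0 ab1.
by rewrite /phase eT eP -addnn -!natr1 natrD; field.
Qed.

Lemma le_sinh_prod h1 h2 : 0 <= h1 -> h1 <= h2 ->
  sinh h1 * sinh (q * h1) <= sinh h2 * sinh (q * h2).
Proof.
move=> h10 h12; apply: ler_pM; rewrite ?sinh_ge0 ?le_sinh ?mulr_ge0//.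
by rewrite ler_pM2l ?q_gt0.
Qed.

Lemma exists_hmax : exists h, 0 < h /\ sinh h * sinh (q * h) = 1.
Proof.
pose f (h : R) := sinh h * sinh (q * h).
have f0 : f 0 = 0 by rewrite /f sinh0 mul0r.
have f1 : 1 <= f 1.
  have a1 := sinh_ge (ler01 : 0 <= 1 :> R).
  have q1 := q_ge1 R m; have b1 := sinh_ge (le_trans ler01 q1).
  by rewrite /f mulr1; nra.
have [||h hI fh] := @IVT R f 0 1 1 ler01.
- apply: continuous_subspaceT => h; apply: cvgM; first exact: continuous_sinh.
  by apply: continuous_scaled; exact: continuous_sinh.
- by rewrite f0 ge_min le_max ler01 f1 orbT.
exists h; split=> //; rewrite lt_neqAle; move: hI; rewrite in_itv /= => /andP[-> _].
rewrite andbT; apply: contra_eq_neq fh => <-; by rewrite f0 eq_sym oner_neq0.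
Qed.

Definition hmax : R := xget 0 [set h | 0 < h /\ sinh h * sinh (q * h) = 1].

Lemma hmaxP : 0 < hmax /\ sinh hmax * sinh (q * hmax) = 1.
Proof. exact: (@xgetPex _ 0 [set h | 0 < h /\ _] exists_hmax). Qed.

(* The parameter h of the eigenvalue labelled k; hmax is the one of the imaginary
   eigenvalue. *)
Definition node (k : nat) : R := xget 0
  [set h | [/\ 0 < h, h <= hmax, sinh h * sinh (q * h) < 1
             & phase m h = 2 * pi * k%:R]].

(** The intermediate value theorem for [phase] on [0, [hmax]], where it goes from 0 to (m+1) pi. *)
Lemma nodeP k : (1 <= k <= m./2)%N ->
  [/\ 0 < node k, node k <= hmax, sinh (node k) * sinh (q * node k) < 1
    & phase m (node k) = 2 * pi * k%:R].
Proof.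
move=> /andP[k1 km]; apply: (@xgetPex _ 0 [set h | [/\ 0 < h, h <= hmax, _ & _]]).
have [h0 hE] := hmaxP; have pi0 := pi_gt0 R.
(* Since 2k <= m, the target phase stays strictly below its end value, so the solution satisfies the
   strict inequality. *)
have kle : k.*2%:R < m.+1%:R :> R by rewrite ltr_nat; lia.
have kE : k.*2%:R = 2 * k%:R :> R by rewrite -mul2n natrM.
have pE := phase_end (ltW h0) hE.
have k0 : 1 <= k%:R :> R by rewrite ler1n.
have pk : 0 < 2 * (pi : R) * k%:R < phase m hmax.
  by rewrite pE; apply/andP; split; nra.
have [||h] := @IVT R (phase m) 0 hmax (2 * pi * k%:R) (ltW h0).
- by apply: continuous_subspaceT; exact: continuous_phase.
- by rewrite phase0 ge_min le_max; case/andP: pk => /ltW-> /ltW->; rewrite orbT.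
rewrite in_itv /= => /andP[hge hle] ph; exists h.
have hn0 : 0 < h.
  rewrite lt_neqAle hge andbT; apply: contraTneq pk => h00.
  by rewrite -ph -h00 phase0 ltxx.
have ab := le_sinh_prod hge hle; rewrite hE in ab.
split=> //; rewrite lt_neqAle ab andbT.
apply: contraTneq pk => ab1.
by rewrite -ph pE (phase_end hge ab1) ltxx andbF.
Qed.

(* The imaginary part of the curve increases with h: this keeps the eigenvalues
   with different k apart. *)
Lemma lt_Im_curve h1 h2 : 0 < h1 -> h1 < h2 ->
  sinh h1 * (cosh h1 * (sinh (q * h1) / cosh (q * h1))) <
  sinh h2 * (cosh h2 * (sinh (q * h2) / cosh (q * h2))).
Proof.
move=> h10 h12; have h20 := lt_trans h10 h12.
have q0 := q_gt0 R m.
have a : sinh h1 < sinh h2 by rewrite lt_sinh.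
have a0 := sinh_gt0 h10.
have b0 : 0 < sinh (q * h1) by rewrite sinh_gt0 ?mulr_gt0.
have c : cosh h1 < cosh h2.
  by have := cosh2 h1; have := cosh2 h2;
    have := cosh_gt0 h1; have := cosh_gt0 h2; nra.
have t : sinh (q * h1) / cosh (q * h1) < sinh (q * h2) / cosh (q * h2).
  rewrite ltr_pdivrMr ?cosh_gt0// mulrAC ltr_pdivlMr ?cosh_gt0//.
  have : 0 < sinh (q * h2 - q * h1) by rewrite sinh_gt0// -mulrBr mulr_gt0// subr_gt0.
  by rewrite sinhD coshN sinhN; lra.
have t0 : 0 <= sinh (q * h1) / cosh (q * h1).
  by rewrite mulr_ge0 ?invr_ge0 ?ltW ?cosh_gt0.
have c0 := ltW (cosh_gt0 h1).
by apply: ltr_pM => //; [exact: ltW|exact: mulr_ge0|apply: ltr_pM].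
Qed.

Lemma Re_Im_node k : (1 <= k <= m./2)%N ->
  0 < complex.Re (curve m (node k)) /\ 0 < complex.Im (curve m (node k)).
Proof.
move=> /nodeP[h0 _ ab ph] /=.
have [_ _ [sT cT] _] := curve_angles (ltW h0) (ltW ab).
have qh0 : 0 < q * node k by rewrite mulr_gt0 ?q_gt0.
have ab2 : 0 < 1 - (sinh (node k) * sinh (q * node k)) ^+ 2.
  by rewrite subr_gt0 expr_lt1//; apply: mulr_ge0; rewrite sinh_ge0 ?ltW.
split; apply: mulr_gt0.
- by rewrite mulr_gt0 ?cosh_gt0.
- by rewrite cT; apply: divr_gt0; rewrite ?cosh_gt0 ?sqrtr_gt0.
- by rewrite mulr_gt0 ?sinh_gt0.
rewrite sT; apply: mulr_gt0; rewrite ?cosh_gt0//.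
by apply: divr_gt0; rewrite ?cosh_gt0 ?sinh_gt0.
Qed.

(** By [lt_Im_curve] the imaginary part determines h, and the phase at h determines k. *)
Lemma node_Im_inj k k' : (1 <= k <= m./2)%N -> (1 <= k' <= m./2)%N ->
  complex.Im (curve m (node k)) = complex.Im (curve m (node k')) -> k = k'.
Proof.
move=> kI k'I; have [h0 _ ab ph] := nodeP kI; have [h0' _ ab' ph'] := nodeP k'I.
have [_ _ [sT _] _] := curve_angles (ltW h0) (ltW ab).
have [_ _ [sT' _] _] := curve_angles (ltW h0') (ltW ab').
have two_neq0 : 2 != 0 :> R by rewrite pnatr_eq0.
have twopi_gt0 : 0 < 2 * pi :> R by rewrite mulr_gt0 ?pi_gt0.
rewrite /= sT sT' -!mulrA => /mulfI -/(_ two_neq0) E.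
have hh : node k = node k'.
  by have [/(lt_Im_curve h0)|/(lt_Im_curve h0')|//] := ltgtP (node k) (node k');
    rewrite -!mulrA E ltxx.
have := ph; rewrite hh ph' => /(mulfI (lt0r_neq0 twopi_gt0)) /eqP.
by rewrite eqr_nat => /eqP.
Qed.

Definition eigval (k : nat) (s t : bool) : R[i] :=
  Complex ((-1) ^+ s * complex.Re (curve m (node k)))
          ((-1) ^+ t * complex.Im (curve m (node k))).

(** [charE] is even and has real coefficients: negation and conjugation generate all four sign
    changes. *)
Lemma charE_sym (z : R[i]) (s t : bool) : charE m z = 0 ->
  charE m (Complex ((-1) ^+ s * complex.Re z) ((-1) ^+ t * complex.Im z)) = 0.
Proof.
move=> Ez.
have EN (u : R[i]) : charE m u = 0 -> charE m (- u) = 0 by rewrite charEN.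
have EC (u : R[i]) : charE m u = 0 -> charE m (conjc u) = 0.
  by move=> Eu; rewrite -(charE_rmorph (@conjc R)) Eu rmorph0.
case: z Ez => a b Ez.
case: s; case: t; rewrite /= !(expr0, expr1, mul1r, mulN1r).
- exact: EN _ Ez.
- have -> : Complex (- a) b = - conjc (Complex a b).
    by apply/eqP; rewrite eq_complex /= opprK !eqxx.
  exact: EN _ (EC _ Ez).
- exact: EC _ Ez.
- exact: Ez.
Qed.

Lemma charE_eigval k s t : (1 <= k <= m./2)%N -> charE m (eigval k s t) = 0.
Proof.
move=> /nodeP[h0 _ ab ph]; apply: charE_sym.
exact: curve_charE h0 (ltW ab) ph.
Qed.

Lemma eigval_neq0 k s t : (1 <= k <= m./2)%N ->
  complex.Re (eigval k s t) != 0 /\ complex.Im (eigval k s t) != 0.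
Proof.
move=> /Re_Im_node[re im] /=.
by split; rewrite mulf_neq0 ?signr_eq0 ?lt0r_neq0.
Qed.

Lemma sign_pos_inj (s t : bool) (a b : R) : 0 < a -> 0 < b ->
  (-1) ^+ s * a = (-1) ^+ t * b -> s = t /\ a = b.
Proof.
by case: s; case: t; rewrite !(expr0, expr1, mul1r, mulN1r); split=> //; lra.
Qed.

Lemma eigval_inj k k' s s' t t' : (1 <= k <= m./2)%N -> (1 <= k' <= m./2)%N ->
  eigval k s t = eigval k' s' t' -> [/\ k = k', s = s' & t = t'].
Proof.
move=> kI k'I [/= eR eI].
have [re im] := Re_Im_node kI; have [re' im'] := Re_Im_node k'I.
have [-> _] := sign_pos_inj re re' eR; have [-> e] := sign_pos_inj im im' eI.
by split=> //; exact: node_Im_inj.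
Qed.

Definition imag_eigval : R := 2 * sinh hmax.

Lemma imag_eigval_gt0 : 0 < imag_eigval.
Proof. by have [h0 _] := hmaxP; rewrite mulr_gt0 ?sinh_gt0. Qed.

(** For odd m the end phase (m+1) pi is an integer multiple of 2 pi, so [curve_charE] applies at
    [hmax]. *)
Lemma charE_imag : odd m ->
  charE m (Complex 0 imag_eigval) = 0 /\ charE m (Complex 0 (- imag_eigval)) = 0.
Proof.
move=> om; have [h0 ab] := hmaxP.
have E : charE m (curve m hmax) = 0.
  apply: (@curve_charE _ _ _ (m.+1)./2 h0); first by rewrite ab.
  rewrite (phase_end (ltW h0) ab).
  have -> : m.+1%:R = 2 * (m.+1)./2%:R :> R.
    by rewrite -natrM mul2n; congr (_%:R); lia.
  by ring.
have cE : curve m hmax = Complex 0 imag_eigval.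
  have [e _] := angles_end (ltW h0) ab.
  by rewrite /curve e cos_pihalf sin_pihalf mulr0 mulr1.
rewrite cE in E; split=> //.
by have := charE_sym false true E; rewrite /= expr1 mulr0 mulN1r.
Qed.

Definition eigvals : seq R[i] :=
  [seq eigval p.1 p.2.1 p.2.2 | p <- [seq (k, st) | k <- iota 1 m./2,
     st <- [seq (s, t) | s <- [:: false; true], t <- [:: false; true]]]]
  ++ (if odd m then [:: Complex 0 imag_eigval; Complex 0 (- imag_eigval)] else [::]).

Lemma eigvals_regularP z :
  reflect (exists k s t, (1 <= k <= m./2)%N /\ z = eigval k s t)
    (z \in [seq eigval p.1 p.2.1 p.2.2 | p <- [seq (k, st) | k <- iota 1 m./2,
     st <- [seq (s, t) | s <- [:: false; true], t <- [:: false; true]]]]).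
Proof.
apply: (iffP mapP) => [[p /allpairsP[[k st] /= [kI _ ->] ->]]|[k [s [t [kI ->]]]]].
  by exists k, st.1, st.2; split=> //; move: kI; rewrite mem_iota; lia.
exists (k, (s, t)) => //; apply/allpairsP; exists (k, (s, t)) => /=.
by split=> //; [rewrite mem_iota; lia|case: s; case: t].
Qed.

Lemma eigvals_uniq : uniq eigvals.
Proof.
rewrite cat_uniq; apply/and3P; split.
- rewrite map_inj_in_uniq.
    by apply: allpairs_uniq => //;
      [exact: iota_uniq|move=> [a b] [c d] _ _ /= [-> ->]].
  move=> p p' pI p'I.
  have /allpairsP[[k st] [kI _ ->]] := pI.
  have /allpairsP[[k' st'] [k'I _ ->]] := p'I.
  rewrite mem_iota /= in kI; rewrite mem_iota /= in k'I.
  by move=> /= /eigval_inj[||-> e1 e2]; [lia|lia|];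
    case: st st' e1 e2 => [? ?] [? ?] /= -> ->.
- apply/hasPn => z zI; apply/negP => /eigvals_regularP[k [s [t [kI zE]]]].
  have [re _] := eigval_neq0 s t kI; move: re; rewrite -zE.
  by move: zI; case: ifP => // _; rewrite !inE => /orP[] /eqP -> /=; rewrite eqxx.
case: ifP => // _; rewrite /= inE eq_complex /= eqxx /= andbT.
by have y0 := imag_eigval_gt0; rewrite gt_eqF //; lra.
Qed.

(** Four sign choices for each of the floor(m/2) labels, and two more values when m is odd. *)
Lemma size_eigvals : size eigvals = m.*2.
Proof.
rewrite size_cat size_map size_allpairs size_iota /=.
by case: ifP => /= om; lia.
Qed.

Lemma pencil_eigenvalueP (z : R[i]) :
  pencil_eigenvalue m z <->
  (exists k s t, (1 <= k <= m./2)%N /\ z = eigval k s t) \/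
  odd m /\ (z = Complex 0 imag_eigval \/ z = Complex 0 (- imag_eigval)).
Proof.
have mE : z \in eigvals <->
  (exists k s t, (1 <= k <= m./2)%N /\ z = eigval k s t) \/
  odd m /\ (z = Complex 0 imag_eigval \/ z = Complex 0 (- imag_eigval)).
  rewrite mem_cat; split=> [/orP[/eigvals_regularP|]|[/eigvals_regularP ->//|]].
    by left.
    by case: ifP => // om; rewrite !inE => /orP[] /eqP; right; split=> //; [left|right].
  by move=> [-> zE]; rewrite !inE; apply/orP; right; apply/orP;
    case: zE => ->; [left|right]; rewrite eqxx.
have rE : {in eigvals, forall z, charE m z = 0}.
  move=> u; rewrite mem_cat => /orP[/eigvals_regularP[k [s [t [kI ->]]]]|].
    exact: charE_eigval.
  by case: ifP => // /charE_imag[e1 e2]; rewrite !inE => /orP[] /eqP ->.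
rewrite pencil_eigenvalueE; split=> [/eqP Ez|/mE /rE ->]; last exact: eqxx.
apply/mE; exact: charE_roots eigvals_uniq size_eigvals rE Ez.
Qed.

End Nodes.

(** * Asymptotics *)

Section Asymptotics.
Variable R : realType.
Implicit Types x y d h eps : R.

(** For y <= x the addition formula gives cosh(x-y) cosh y <= cosh x, so 1 + (x-y)^2/2 <= 1 + d. The
    two hypotheses keep the statement symmetric. *)
Lemma cosh_ratio x y d : 0 <= x -> 0 <= y ->
  cosh x <= (1 + d) * cosh y -> cosh y <= (1 + d) * cosh x ->
  (x - y) ^+ 2 <= 2 * d.
Proof.
wlog yx : x y / y <= x.
  move=> H x0 y0 h1 h2; have [yx|/ltW xy] := leP y x; first exact: H.
  by rewrite -sqrrN opprB; exact: H.
move=> x0 y0 xy _.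
have d0 : 0 <= x - y by rewrite subr_ge0.
have e : x = (x - y) + y by rewrite subrK.
have : cosh (x - y) * cosh y <= cosh x.
  by rewrite [in leRHS]e (coshD (x - y) y) lerDl mulr_ge0 ?sinh_ge0.
have := cosh_ge (x - y); have := cosh_gt0 y; nra.
Qed.

Lemma tanh_ge0 x : 0 <= x -> 0 <= sinh x / cosh x.
Proof. by move=> x0; apply: divr_ge0; [exact: sinh_ge0|exact: ltW (cosh_gt0 _)]. Qed.

Lemma tanh_le1 x : sinh x / cosh x <= 1.
Proof.
rewrite ler_pdivrMr ?cosh_gt0// mul1r.
by have := cosh2 x; have := cosh_gt0 x; nra.
Qed.

Lemma le_cosh x y : 0 <= x -> x <= y -> cosh x <= cosh y.
Proof.
move=> x0 xy; have a0 := sinh_ge0 x0.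
have ab : sinh x <= sinh y by rewrite le_sinh.
by have := cosh2 x; have := cosh2 y; have := cosh_gt0 x; have := cosh_gt0 y; nra.
Qed.

Lemma sinh_le_cosh x : 0 <= x -> sinh x <= x * cosh x.
Proof.
move=> x0.
have [|c] := @MVT_segment R (@sinh R) (@cosh R) 0 x x0 (fun t _ => is_derive_sinh t).
  by apply: continuous_subspaceT; exact: continuous_sinh.
rewrite in_itv /= sinh0 !subr0 => /andP[c0 cx] ->.
by rewrite mulrC ler_wpM2l// le_cosh.
Qed.

Lemma xtanh_lipschitz x y : 0 <= x -> 0 <= y ->
  `|x * (sinh x / cosh x) - y * (sinh y / cosh y)| <= 2 * `|x - y|.
Proof.
wlog yx : x y / y <= x.
  move=> H x0 y0; have [yx|/ltW xy] := leP y x; first exact: H.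
  by rewrite distrC (distrC x); exact: H.
move=> x0 y0.
have d0 : 0 <= x - y by rewrite subr_ge0.
have Cx := cosh_gt0 x; have Cy := cosh_gt0 y.
(* The difference of the hyperbolic tangents is sinh(x-y)/(cosh x cosh y). Each of the two terms is
   then at most x - y. *)
have -> : x * (sinh x / cosh x) - y * (sinh y / cosh y) =
    (x - y) * (sinh x / cosh x) + (y / cosh y) * (sinh (x - y) / cosh x).
  rewrite sinhD coshN sinhN; field.
  by rewrite !lt0r_neq0.
have t0 := tanh_ge0 x0; have t1 := tanh_le1 x.
have u0 : 0 <= y / cosh y by rewrite divr_ge0// ltW.
have u1 : y / cosh y <= 1.
  by rewrite ler_pdivrMr// mul1r (le_trans _ (cosh_ge y))//; nra.
have v0 : 0 <= sinh (x - y) / cosh x.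
  by apply: divr_ge0; [exact: sinh_ge0|exact: ltW].
have v1 : sinh (x - y) / cosh x <= x - y.
  rewrite ler_pdivrMr// (le_trans (sinh_le_cosh d0))// ler_wpM2l// le_cosh//.
  by lra.
rewrite !ger0_norm//; last by apply: addr_ge0; apply: mulr_ge0.
by nra.
Qed.

(* In the variable x with cosh x = 1/u, i.e. x = artanh(sqrt(1 - u^2)). *)
Lemma Lambda0_hyperbolic u : 0 < u -> u <= 1 ->
  exists x : R, [/\ 0 <= x, cosh x * u = 1 &
    Lambda0 (2 * u) = 2 * (x * (sinh x / cosh x))].
Proof.
move=> u0 u1.
pose S := Num.sqrt (1 - u ^+ 2).
have S0 : 0 <= S by rewrite sqrtr_ge0.
have S2 : S ^+ 2 = 1 - u ^+ 2 by rewrite sqr_sqrtr//; nra.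
have pos : 0 < (1 + S) / u by rewrite divr_gt0//; lra.
exists (ln ((1 + S) / u)).
have e1 : expR (ln ((1 + S) / u)) = (1 + S) / u by rewrite lnK.
have e2 : expR (- ln ((1 + S) / u)) = (1 - S) / u.
  rewrite expRN e1 invf_div; apply/eqP; rewrite eqr_div ?lt0r_neq0//; last by lra.
  by apply/eqP; nra.
have nu : u != 0 by rewrite lt0r_neq0.
have ec : cosh (ln ((1 + S) / u)) = u^-1 by rewrite /cosh e1 e2; field.
have es : sinh (ln ((1 + S) / u)) = S / u by rewrite /sinh e1 e2; field.
split.
- by rewrite ln_ge0// ler_pdivlMr//; lra.
- by rewrite ec mulVf.
rewrite ec es /Lambda0.
have -> : 2 * u / 2 = u by field.
have -> : Num.sqrt (4 - (2 * u) ^+ 2) = 2 * S.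
  have -> : 4 - (2 * u) ^+ 2 = (2 * S) ^+ 2 by rewrite !exprMn S2; ring.
  by rewrite sqrtr_sqr ger0_norm// mulr_ge0.
have -> : tan (pi / 4 + acos u / 2) = (1 + S) / u.
  have uI : u \in `[(-1), 1] by rewrite in_itv /=; apply/andP; split; lra.
  have uI' : -1 <= u <= 1 by move: uI; rewrite in_itv.
  (* With 2t = arccos u + pi/2 one has sin 2t = u and cos 2t = -S, so that tan t = (1 - cos 2t)/sin
     2t. *)
  pose t : R := pi / 4 + acos u / 2.
  have t2 : 2 * t = acos u + pi / 2 by rewrite /t; field.
  have st : sin (2 * t) = u by rewrite t2 sinDpihalf acosK.
  have ct : cos (2 * t) = - S by rewrite t2 cosDpihalf sin_acos.
  rewrite -/t /tan.
  rewrite mulr_natl sin_mulr2n in st; rewrite mulr_natl cos_mulr2n in ct.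
  have ss := cos2Dsin2 t.
  have c0 : cos t != 0 by apply: contra_eq_neq st => ->; rewrite mul0r mul0rn lt_eqF.
  apply/eqP; rewrite eqr_div//; apply/eqP.
  have SE : S = sin t ^+ 2 - cos t ^+ 2.
    by apply: oppr_inj; rewrite -ct -ss; ring.
  by rewrite -st SE -ss; ring.
by field.
Qed.

Lemma ln_nat_large (b : R) : exists M, forall n, (M <= n)%N -> b <= ln (n%:R : R).
Proof.
exists (Num.bound (expR b)) => n Mn.
have h : expR b < n%:R.
  by rewrite (lt_le_trans (archi_boundP (expR_ge0 b)))// ler_nat.
have n0 : 0 < n%:R :> R := lt_trans (expR_gt0 b) h.
by rewrite -ler_expR lnK ?posrE// ltW.
Qed.

(** Keeps the cubic term of the exponential series at ln x. *)
Lemma ln_sqr_le (x : R) : 0 < ln x -> ln x ^+ 2 / x <= 6 / ln x.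
Proof.
move=> l0.
have x0 : 0 < x by rewrite ltNge; apply/negP => /ln0 e; rewrite e ltxx in l0.
have := expR_ge1Dxn 2 (ltW l0); rewrite lnK ?posrE// => h.
rewrite ler_pdivrMr// mulrAC ler_pdivlMr// -exprSr.
by move: h; rewrite (_ : 3`!%:R = 6 :> R)//; lra.
Qed.

(** * Quantitative estimates along the curve *)

Section Estimates.
Variable m : nat.
Local Notation q := (m.*2.+1%:R : R).
Local Notation L := (ln (m%:R : R)).

Hypothesis L9 : 9 <= L.

Lemma ln_large_pos : 1 < m%:R :> R.
Proof. by rewrite ltNge; apply/negP => /ln_le0 l0; have := L9; lra. Qed.

(** At x = L/(2m) the product sinh x sinh(qx) is at least x m/4 = L/8, which exceeds 1 as [9 <= L];
    monotonicity then places [hmax] below x. *)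
Lemma hmax_le : hmax R m <= L / (2 * m%:R).
Proof.
have m1 := ln_large_pos; have [h0 ab] := hmaxP R m.
have m0 : 0 < m%:R :> R by lra.
rewrite leNgt; apply/negP => xh.
pose x : R := L / (2 * m%:R).
have x0 : 0 <= x by apply: divr_ge0; have := L9; lra.
have xm : x * (2 * m%:R) = L by rewrite /x divfK// lt0r_neq0//; lra.
have := le_sinh_prod m x0 (ltW xh); rewrite ab; apply/negP; rewrite -ltNge.
have q2 : q = 2 * m%:R + 1 by rewrite -natr1 -mul2n natrM.
have b : sinh L <= sinh (q * x) by rewrite le_sinh q2; nra.
have sL : sinh L = (m%:R - m%:R^-1) / 2 by rewrite /sinh expRN lnK.
have m2 : m%:R^-1 <= 1 :> R by rewrite invf_le1// ltW.
have m3 : 2 <= m%:R :> R by rewrite ler_nat -(ltr_nat R).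
have m4 : m%:R / 4 <= sinh L by rewrite sL; lra.
have sx := sinh_ge x0.
have : x * (m%:R / 4) <= sinh x * sinh (q * x) by apply: ler_pM; lra.
by rewrite (_ : x * (m%:R / 4) = L / 8) => [H|]; [have := L9; lra|rewrite -xm; field].
Qed.

Lemma hmax_small : hmax R m <= L ^+ 2 / m%:R / 18.
Proof.
have m1 := ln_large_pos; apply: (le_trans hmax_le).
have m0 : 0 < m%:R :> R by lra.
have -> : L ^+ 2 / m%:R / 18 = L / 9 * (L / (2 * m%:R)).
  by field; rewrite lt0r_neq0.
by rewrite ler_peMl//; [apply: divr_ge0|]; have := L9; lra.
Qed.

Lemma sqr_hmax_small : m%:R * hmax R m ^+ 2 <= L ^+ 2 / m%:R / 4.
Proof.
have m1 := ln_large_pos; have [h0 _] := hmaxP R m.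
have m0 : 0 < m%:R :> R by lra.
have -> : L ^+ 2 / m%:R / 4 = m%:R * (L / (2 * m%:R)) ^+ 2.
  by field; rewrite lt0r_neq0.
rewrite ler_pM2l// ler_pXn2r ?nnegrE ?hmax_le// ?(ltW h0)//.
exact: le_trans (ltW h0) hmax_le.
Qed.

(** The last hypothesis says that tan psi = sinh h / cos theta is at most eta/2, that is, the point
    is far enough from the imaginary axis. The condition on L absorbs the errors of order h and m
    h^2. *)
Lemma curve_estimates h eta : 0 < h -> h <= hmax R m ->
  sinh h * sinh (q * h) < 1 ->
  0 < eta -> eta <= 1 -> 4 * (L ^+ 2 / m%:R) <= eta ^+ 2 ->
  2 * sinh h <= eta * cos (theta m h) ->
  `|complex.Im (curve m h) - Lambda0 (complex.Re (curve m h)) / (2 * m)%:R|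
    <= 5 * eta / m%:R /\
  `|complex.Re (curve m h) - 2 * cos (theta m h + psi m h / q)| <= 2 * eta / m%:R.
Proof.
move=> h0 hM ab eta0 eta1 Keta rho.
have eta2 : 0 <= eta ^+ 2 <= 1 by rewrite sqr_ge0 expr_le1// ltW.
have m1 := ln_large_pos; have m0 : 0 < m%:R :> R by lra.
have q0 := q_gt0 R m; have q2 : q = 2 * m%:R + 1 by rewrite -natr1 -mul2n natrM.
set K := L ^+ 2 / m%:R in Keta.
have K1 : K <= eta ^+ 2 / 4 by lra.
have K2 : K <= eta / 4 by nra.
have hK : h <= K / 18 by exact: le_trans hM hmax_small.
have hI2 : 0 <= 2 * h <= 2^-1 by apply/andP; split; lra.
have mh2 : m%:R * h ^+ 2 <= K / 4.
  apply: le_trans sqr_hmax_small; rewrite ler_pM2l// ler_pXn2r ?nnegrE//;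
    first exact: ltW.
  exact: le_trans (ltW h0) hM.
have h2 : h ^+ 2 <= K / 4.
  by apply: le_trans mh2; rewrite ler_peMl ?sqr_ge0// ltW.
have sh0 := sinh_gt0 h0.
have sh1 : sinh h <= 2 * h.
  have hI : 0 <= h <= 2^-1 by apply/andP; split; lra.
  by apply: (le_trans (sinh_le hI)); nra.
have sh2 : sinh h ^+ 2 <= 4 * h ^+ 2 by nra.
have [XI YI [sT cT] [sP cP]] := curve_angles (ltW h0) (ltW ab).
set D := Num.sqrt _ in cT cP.
have D0 : 0 < D.
  by rewrite sqrtr_gt0 subr_gt0 expr_lt1//;
    apply: mulr_ge0; rewrite sinh_ge0 ?mulr_ge0 ?ltW.
have D1 : D <= 1.
  by rewrite -[leRHS]sqrtr1 ler_wsqrtr// lerBlDr lerDl sqr_ge0.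
have c0 := cosh_gt0 h; have cA0 := cosh_gt0 (q * h).
have cT0 : 0 < cos (theta m h) by rewrite cT; exact: divr_gt0.
have DA : D = cos (theta m h) * cosh (q * h) by rewrite cT divfK ?lt0r_neq0.
have DP : D = cos (psi m h) * cosh h by rewrite cP divfK ?lt0r_neq0.
have cP0 : 0 < cos (psi m h) by rewrite cP; exact: divr_gt0.
have sPr : sin (psi m h) * cos (theta m h) = sinh h * cos (psi m h).
  by rewrite sP cT cP; field; rewrite !lt0r_neq0.
have sP1 : sin (psi m h) <= eta / 2.
  rewrite -(ler_pM2r cT0) sPr; have := cos_le1 (psi m h); nra.
have [P0 _ P2] := arcsin_bounds YI; rewrite -/(psi m h) -sP in P0 P2.
have sP0 : 0 <= sin (psi m h) by case/andP: YI; rewrite -sP.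
have cP1 : 1 - eta ^+ 2 / 4 <= cos (psi m h).
  have := cos2Dsin2 (psi m h); have := cos_le1 (psi m h).
  by clear - sP0 sP1 cP0 eta0; nra.
have ch1 := cosh_ge1 h; have ch2 := cosh_le h.
split; last first.
  (* Two errors: cosh h against 1, of order h^2, and the shift of the angle by psi/q. *)
  have -> : complex.Re (curve m h) - 2 * cos (theta m h + psi m h / q) =
      2 * (cosh h - 1) * cos (theta m h) -
      2 * (cos (theta m h + psi m h / q) - cos (theta m h)) by rewrite /=; ring.
  apply: (le_trans (ler_normB _ _)); rewrite ger0_norm; last first.
    by apply: mulr_ge0; [apply: mulr_ge0; rewrite ?subr_ge0|exact: ltW].
  rewrite normrM ger0_norm//.
  have pq : 0 <= psi m h / q by rewrite divr_ge0// ltW.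
  have := @cos_lipschitz R (theta m h) (theta m h + psi m h / q).
  rewrite lerDl addrAC subrr add0r => /(_ pq) lip.
  have pm : psi m h / q * (2 * m%:R) <= psi m h.
    by rewrite mulrAC ler_pdivrMr// ler_wpM2l// q2 lerDl.
  rewrite ler_pdivlMr// mulrDl.
  have t1 : 2 * (cosh h - 1) * cos (theta m h) * m%:R <= 8 * (m%:R * h ^+ 2).
    have := cos_le1 (theta m h).
    have : (cosh h - 1) * cos (theta m h) <= 4 * h ^+ 2.
      by have := cos_le1 (theta m h); clear - cT0 ch1 ch2 sh2; nra.
    by clear - m0; nra.
  have t2 : 2 * `|cos (theta m h + psi m h / q) - cos (theta m h)| * m%:R <= psi m h.
    by apply: le_trans pm; rewrite -mulrA [leRHS]mulrCA ler_pM2l// ler_wpM2r// ltW.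
  lra.
pose u := cosh h * cos (theta m h).
have u0 : 0 < u by exact: mulr_gt0.
have u1 : u <= 1.
  have : cosh h <= cosh (q * h).
    by apply: le_cosh; [exact: ltW|rewrite ler_peMl ?q_ge1 ?ltW].
  move=> hq; rewrite /u -(ler_pM2r cA0) -mulrA -DA mul1r.
  by apply: le_trans hq; rewrite ler_piMr// ltW.
have [x [x0 xu xL]] := Lambda0_hyperbolic u0 u1.
have -> : complex.Re (curve m h) = 2 * u by rewrite /u /= mulrA.
have A0 : 0 <= q * h by rewrite mulr_ge0// ltW.
(* As cosh x = 1/u, the ratio cosh(qh)/cosh x is cosh h times [D], which is within eta^2 of 1. *)
have Au : cosh (q * h) * u = cosh h * D by rewrite DA /u; ring.
have cl : (q * h - x) ^+ 2 <= 2 * eta ^+ 2.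
  apply: cosh_ratio => //; rewrite -(ler_pM2r u0) -[leRHS]mulrA ?xu Au.
    by rewrite mulr1; clear - ch1 ch2 sh2 h2 K1 D0 D1; nra.
  have : 1 - eta ^+ 2 / 4 <= D by rewrite DP; clear - cP1 cP0 ch1; nra.
  move=> D2; have : 1 - eta ^+ 2 / 4 <= cosh h * D by clear - D2 ch1 D0; nra.
  by case/andP: eta2; clear; nra.
have cl1 : `|q * h - x| <= 2 * eta.
  rewrite -(@ler_pXn2r _ 2) ?nnegrE ?normr_ge0 ?mulr_ge0 ?(ltW eta0)//.
  by rewrite real_normK ?num_real// exprMn; clear - cl; nra.
have lp := xtanh_lipschitz A0 x0.
have [h20 _] := andP hI2.
have s2 := sinh_ge h20; have s2' := sinh_le hI2.
have e2 : sinh (2 * h) = 2 * (sinh h * cosh h).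
  by rewrite (_ : 2 * h = h + h) ?sinhD; ring.
have t0 := tanh_ge0 A0; have t1 := tanh_le1 (q * h).
have d1 : `|m%:R * sinh (2 * h) - q * h| <= K.
  rewrite ler_norml q2; apply/andP; split.
    have : m%:R * (2 * h) <= m%:R * sinh (2 * h) by rewrite ler_pM2l.
    by clear - hK h0; lra.
  have : m%:R * sinh (2 * h) <= m%:R * (2 * h + (2 * h) ^+ 2) by rewrite ler_pM2l.
  by clear - mh2 h0; lra.
(* Multiplied by m, the error splits into replacing m sinh(2h) by qh, and replacing qh by x in x
   tanh x. *)
have -> : complex.Im (curve m h) - Lambda0 (2 * u) / (2 * m)%:R =
    ((m%:R * sinh (2 * h) - q * h) * (sinh (q * h) / cosh (q * h)) +
     (q * h * (sinh (q * h) / cosh (q * h)) - x * (sinh x / cosh x))) / m%:R.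
  rewrite /= sT xL e2 natrM; field.
  by rewrite !lt0r_neq0 ?cosh_gt0.
rewrite normrM normfV (ger0_norm (ltW m0)) ler_pM2r ?invr_gt0//.
apply: (le_trans (ler_normD _ _)); rewrite normrM (ger0_norm t0).
have := ler_piMr (normr_ge0 (m%:R * sinh (2 * h) - q * h)) t1; clear - d1 lp cl1 K2 eta0; lra.
Qed.

End Estimates.
End Asymptotics.

(** The upper bound comes from [hmax_le]. For the lower one, m sinh h <= L gives sinh(qh) >= m/L,
    hence qh >= L - ln L, with ln L <= 2 sqrt L. *)
Lemma imag_eigval_estimate (R : realType) m : 9 <= ln (m%:R : R) ->
  `|1 - imag_eigval R m / (ln m%:R / m%:R)| <= 3 / Num.sqrt (ln m%:R).
Proof.
set L := ln _ => L9.
have m1 := ln_large_pos L9; have m0 : 0 < m%:R :> R by lra.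
have q2 : m.*2.+1%:R = 2 * m%:R + 1 :> R by rewrite -natr1 -mul2n natrM.
have [h0 ab] := hmaxP R m; have hL := hmax_le L9.
rewrite -/L in hL; rewrite /imag_eigval; set h := hmax R m in h0 ab hL *.
have L0 : 0 < L by lra.
have hm : 2 * (m%:R * h) <= L.
  by move: hL; rewrite ler_pdivlMr; lra.
have Lm : L < m%:R by exact: ln_sublinear.
have h1 : h <= 2^-1 by nra.
have hI : 0 <= h <= 2^-1 by rewrite ltW.
have s1 := sinh_ge (ltW h0); have s2 := sinh_le hI.
have sh0 := sinh_gt0 h0.
have s3 : m%:R * sinh h <= L by nra.
have qh : L - ln L <= m.*2.+1%:R * h.
  rewrite -ler_expR expRB !lnK ?posrE//.
  rewrite ler_pdivrMr//.
  have e : sinh (m.*2.+1%:R * h) <= expR (m.*2.+1%:R * h).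
    by rewrite expR_coshDsinh lerDr ltW ?cosh_gt0.
  have b0 : 0 <= sinh (m.*2.+1%:R * h) by rewrite sinh_ge0 ?mulr_ge0 ?ltW.
  have : m%:R <= L * sinh (m.*2.+1%:R * h).
    have -> : m%:R = m%:R * sinh h * sinh (m.*2.+1%:R * h) by rewrite -mulrA ab mulr1.
    by rewrite ler_wpM2r.
  by move=> /le_trans; apply; rewrite mulrC ler_wpM2r// ltW.
set s := Num.sqrt L.
have ss : s ^+ 2 = L by rewrite sqr_sqrtr// ltW.
have s0 : 0 < s by rewrite sqrtr_gt0.
have sg1 : 1 <= s by nra.
have lnL : ln L <= 2 * s.
  by rewrite -ss lnXn// -[ln s *+ 2]mulr_natl ler_wpM2l// ltW// ln_sublinear//.
have -> : 1 - 2 * sinh h / (L / m%:R) = (L - 2 * (m%:R * sinh h)) / L.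
  by field; rewrite !lt0r_neq0.
rewrite normrM normfV (gtr0_norm L0) -ss ler_pdivrMr ?exprn_gt0//.
have -> : 3 / s * s ^+ 2 = 3 * s by field; rewrite lt0r_neq0.
rewrite ss ler_norml; rewrite q2 in qh.
have ms1 : m%:R * h <= m%:R * sinh h by rewrite ler_pM2l.
have ms2 : m%:R * sinh h <= m%:R * (h + h ^+ 2) by rewrite ler_pM2l.
(* Bounds the quadratic error, since 2 m h^2 <= L h. *)
have Lh : L * h <= 1.
  apply: (@le_trans _ _ (L ^+ 2 / m%:R / 2)).
    by rewrite expr2 -!mulrA ler_pM2l// (le_trans hL)// invfM [_^-1 * _]mulrC.
  have := ln_sqr_le L0; have : 6 / L <= 1 by rewrite ler_pdivrMr//; lra.
  by rewrite -/L; lra.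
have mh2 : m%:R * h ^+ 2 * 2 <= 1.
  by apply: le_trans Lh; have := ler_wpM2r (ltW h0) hm; lra.
by apply/andP; split; lra.
Qed.

Lemma regular_estimates (R : realType) (eps : R) : 0 < eps ->
  exists (C : R) (M : nat), forall (m k : nat) (s t : bool),
    (M <= m)%N -> (1 <= k <= m./2)%N ->
    C * (ln m%:R / m%:R)
      <= Num.max `|complex.Re (eigval R m k s t)| (limit_re R m k) ->
    `|complex.Im (eigval R m k s t)
      - (-1) ^+ t * (Lambda0 `|complex.Re (eigval R m k s t)| / (2 * m)%:R)|
      <= eps / m%:R
    /\ `|complex.Re (eigval R m k s t) - (-1) ^+ s * limit_re R m k|
      <= eps / m%:R.
Proof.
move=> eps0; pose eta := Num.min 1 (eps / 5).
have eta0 : 0 < eta by rewrite lt_min ltr01 divr_gt0.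
have eta1 : eta <= 1 by rewrite ge_min lexx.
have eta_eps : 5 * eta <= eps.
  by rewrite mulrC -ler_pdivlMr// ge_min lexx orbT.
have [M1 M1P] := ln_nat_large (9 : R).
(* Ensures 4 L^2/m <= 24/L <= eta^2, with L = ln m. *)
have [M2 M2P] := ln_nat_large (24 / eta ^+ 2).
exists (8 / eta), (maxn M1 M2) => m k s t.
rewrite geq_max => /andP[/M1P L9 /M2P L24] kI.
have m1 := ln_large_pos L9; have m0 : 0 < m%:R :> R by lra.
have [h0 hM ab ph] := nodeP R kI.
have [re im] := Re_Im_node R kI.
have sg (b : bool) (x : R) : `|(-1) ^+ b * x| = `|x| by rewrite normrMsign.
have -> : complex.Im (eigval R m k s t) =
  (-1) ^+ t * complex.Im (curve m (node R m k)) by [].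
have -> : complex.Re (eigval R m k s t) =
  (-1) ^+ s * complex.Re (curve m (node R m k)) by [].
rewrite sg (gtr0_norm re) -!mulrBr !sg.
set h := node R m k in h0 hM ab ph re im *.
have q0 := q_gt0 R m.
have [XI YI [sT cT] _] := curve_angles (ltW h0) (ltW ab).
have [T0 T1 _] := arcsin_bounds XI; rewrite -/(theta m h) in T0 T1.
have [P0 P1 _] := arcsin_bounds YI; rewrite -/(psi m h) in P0 P1.
(* The phase equation divided by q: theta + psi/q is exactly the limiting angle 2 pi k/q. *)
have lim : limit_re R m k = 2 * cos (theta m h + psi m h / m.*2.+1%:R).
  rewrite /limit_re -ph; congr (2 * cos _).
  by rewrite addn1 mul2n /phase; field; rewrite lt0r_neq0.
have lim_le : limit_re R m k <= 2 * cos (theta m h).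
  rewrite lim ler_pM2l//.
  have Pq : 0 <= psi m h / m.*2.+1%:R <= psi m h.
    rewrite divr_ge0 ?(ltW q0)//= ler_pdivrMr// ler_peMr//; exact: q_ge1.
  case/andP: Pq; move: (psi m h / _) => p Pq0 Pq1.
  move: Pq0; rewrite le_eqVlt => /predU1P[<-|Pq0]; first by rewrite addr0.
  have pi0 := pi_ge0 R.
  apply: ltW; rewrite ltr_cos ?ltrDl// in_itv /=; apply/andP; split; lra.
have K4 : 4 * (ln (m%:R : R) ^+ 2 / m%:R) <= eta ^+ 2.
  have L0 : 0 < ln (m%:R : R) by lra.
  have := ln_sqr_le L0; have : 6 / ln (m%:R : R) <= eta ^+ 2 / 4.
    move: L24; rewrite ler_pdivrMr ?exprn_gt0// => L24.
    by rewrite ler_pdivrMr//; lra.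
  by lra.
have hm : h <= ln (m%:R : R) / (2 * m%:R) := le_trans hM (hmax_le L9).
have eta2 : eta ^+ 2 <= 1 by rewrite expr_le1// ltW.
have h14 : h <= 4^-1 by have := hmax_small L9; lra.
have hI : 0 <= h <= 2^-1 by apply/andP; split; lra.
have sh := sinh_le hI; have sh0 := sinh_gt0 h0.
have sh1 : sinh h <= 2 * h by nra.
have cT0 : 0 < cos (theta m h).
  by move: re; rewrite /= pmulr_rgt0// mulr_gt0 ?cosh_gt0.
move=> far.
(* Both entries of the maximum are at most 4 cos theta, so either being large suffices. The constant
   8/eta then yields 2 sinh h <= 4h <= 2 ln m/m <= eta cos theta. *)
have far4 : 8 / eta * (ln (m%:R : R) / m%:R) <= 4 * cos (theta m h).
  apply: (le_trans far); rewrite ge_max; apply/andP; split; last by lra.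
  have sh2 : sinh h ^+ 2 <= 1 by rewrite expr_le1 ?ltW//; lra.
  have c2 : 2 * cosh h <= 4 by have := cosh_le h; lra.
  by rewrite /= ler_wpM2r// ltW.
have rho : 2 * sinh h <= eta * cos (theta m h).
  have e : 4 * h <= 2 * (ln (m%:R : R) / m%:R).
    by rewrite (_ : 2 * _ = 4 * (ln (m%:R : R) / (2 * m%:R))) ?ler_pM2l//;
       field; rewrite lt0r_neq0.
  have : 8 * (ln (m%:R : R) / m%:R) <= 4 * cos (theta m h) * eta.
    by move: far4; rewrite mulrAC ler_pdivrMr.
  by lra.
have [H1 H2] := curve_estimates L9 h0 hM ab eta0 eta1 K4 rho.
rewrite lim; split.
  by apply: (le_trans H1); rewrite ler_pM2r ?invr_gt0.
by apply: (le_trans H2); rewrite ler_pM2r ?invr_gt0//; lra.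
Qed.

Theorem theorem4p2 (R : realType) :
  (* all eigenvalues are non-real *)
  (forall (m : nat) (z : R[i]), pencil_eigenvalue m z -> complex.Im z != 0) /\
  (* lam m k s t: the eigenvalues off the imaginary axis, indexed by k and by
     the signs (-1)^s of the real part and (-1)^t of the imaginary part *)
  (exists lam : nat -> nat -> bool -> bool -> R[i],
    [/\ forall (m : nat) (z : R[i]), (0 < m)%N ->
          (pencil_eigenvalue m z /\ complex.Re z != 0 <->
           exists (k : nat) (s t : bool),
             (1 <= k <= m./2)%N /\ z = lam m k s t),
        forall (m k k' : nat) (s s' t t' : bool), (0 < m)%N ->
          (1 <= k <= m./2)%N -> (1 <= k' <= m./2)%N ->
          lam m k s t = lam m k' s' t' -> [/\ k = k', s = s' & t = t']
      & (* o(1/m), uniformly over the eigenvalues at distance at least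
           C log(m)/m from the imaginary axis; at smaller distance
           the o(1/m) claim fails *)
        forall eps : R, 0 < eps ->
          exists (C : R) (M : nat), forall (m k : nat) (s t : bool),
            (0 < m)%N -> (M <= m)%N -> (1 <= k <= m./2)%N ->
            C * (ln m%:R / m%:R)
              <= Num.max `|complex.Re (lam m k s t)| (limit_re R m k) ->
            `|complex.Im (lam m k s t)
              - (-1) ^+ t * (Lambda0 `|complex.Re (lam m k s t)| / (2 * m)%:R)|
              <= eps / m%:R
            /\ `|complex.Re (lam m k s t) - (-1) ^+ s * limit_re R m k|
              <= eps / m%:R]) /\
  (* m even: no other eigenvalues *)
  (forall (m : nat) (z : R[i]), ~~ odd m ->
     pencil_eigenvalue m z -> complex.Re z != 0) /\
  (* m odd: exactly two more, +- i y_m with y_m = (log m / m) (1 + o(1)) *)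
  (exists y : nat -> R,
    (forall m : nat, odd m ->
       0 < y m /\
       forall z : R[i],
         (pencil_eigenvalue m z /\ complex.Re z = 0 <->
          z = Complex 0 (y m) \/ z = Complex 0 (- y m))) /\
    (fun j : nat => y j.*2.+1 / (ln j.*2.+1%:R / j.*2.+1%:R)) @ \oo --> (1 : R)).
Proof.
have imag0 m : imag_eigval R m != 0 by rewrite lt0r_neq0 ?imag_eigval_gt0.
split.
  move=> m z /pencil_eigenvalueP[[k [s [t [kI ->]]]]|[_ [|] ->]] /=.
  - by have [] := eigval_neq0 R s t kI.
  - exact: imag0.
  - by rewrite oppr_eq0.
split.
  exists (eigval R); split.
  - move=> m z _; split.
      move=> [/pencil_eigenvalueP[//|[_ [|] ->]]] /=; by rewrite eqxx.
    move=> H; split; first by apply/pencil_eigenvalueP; left.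
    by case: H => k [s [t [kI ->]]]; have [] := eigval_neq0 R s t kI.
  - by move=> m k k' s s' t t' _; exact: eigval_inj.
  - move=> eps /regular_estimates[C [M H]]; exists C, M => m k s t _; exact: H.
split.
  move=> m z em /pencil_eigenvalueP[[k [s [t [kI ->]]]]|[om _]].
    by have [] := eigval_neq0 R s t kI.
  by rewrite om in em.
exists (imag_eigval R); split.
  move=> m om; split; first exact: imag_eigval_gt0.
  move=> z; split.
    move=> [/pencil_eigenvalueP[[k [s [t [kI ->]]]]|[_ //]] re0].
    by have [] := eigval_neq0 R s t kI; rewrite re0 eqxx.
  move=> zE; split; first by apply/pencil_eigenvalueP; right.
  by case: zE => ->.
apply/cvgrPdist_le => eps eps0.
have [M1 M1P] := ln_nat_large (9 : R).
(* Chosen so that the error 3/sqrt(ln m) is at most [eps]. *)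
have [M2 M2P] := ln_nat_large ((3 / eps) ^+ 2).
exists (maxn M1 M2) => // j /= jM.
have : (maxn M1 M2 <= j.*2.+1)%N by lia.
rewrite geq_max => /andP[/M1P L9 /M2P L2].
apply: (le_trans (imag_eigval_estimate L9)).
have L0 : 0 < ln (j.*2.+1%:R : R) by lra.
rewrite ler_pdivrMr ?sqrtr_gt0// mulrC -ler_pdivrMr//.
have <- : Num.sqrt ((3 / eps) ^+ 2) = 3 / eps.
  by rewrite sqrtr_sqr ger0_norm// divr_ge0// ltW.
by rewrite ler_wsqrtr.
Qed.
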